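(* Let $n$ be a natural number, let $a_1,\dots,a_n$ be natural numbers (positive integers), let $b$ be a non-negative integer, and let $m$ be an arbitrary natural number (positive integer). Let $r\in\{0,1,\dots,m-1\}$ be the remainder of $b$ modulo $m$, and let $$s^{*}=\left\lfloor\frac{(m-1)\sum_{i=1}^{n}a_i-r}{m}\right\rfloor .$$ For $k=0,1,\dots,s^{*}$ let $l^{*}_k$ be the number of integer solutions $(t_1,\dots,t_n)$ of the system $$\sum_{i=1}^{n}a_it_i=r+km,\qquad 0\le t_i\le m-1\quad(i=1,2,\dots,n).$$ Then $$P(b)=\sum_{k=0}^{s^{*}}l^{*}_k\,P\Bigl(\left\lfloor\frac{b}{m}\right\rfloor-k\Bigr).$$
   Context: For an integer $l$, $P(l)$ denotes the number of $n$-tuples $(x_1,\dots,x_n)$ of non-negative integers with $\sum_{i=1}^n a_ix_i=l$ (so $P(l)=0$ for $l<0$). *)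

(* Defs.v *)
From mathcomp Require Import all_boot all_order all_algebra.
From mathcomp Require Import finmap.
From mathcomp Require Import boolp classical_sets functions cardinality.

Set Implicit Arguments.
Unset Strict Implicit.
Unset Printing Implicit Defensive.

Import Order.TTheory GRing.Theory Num.Theory.
Local Open Scope classical_set_scope.

(* [fset_set A] is the empty set by convention when [A] is infinite. The sets
   counted below are all finite; see [finite_solutions] and
   [finite_bounded_solutions]. *)
Definition cardinal (T : choiceType) (A : set T) : nat := #|` fset_set A|%fset.

Definition solutions n (a : 'I_n -> nat) (l : int) : set (n.-tuple nat) :=
  [set x | ((\sum_(i < n) a i * tnth x i)%N%:Z = l)%R].

Definition P n (a : 'I_n -> nat) (l : int) : nat := cardinal (solutions a l).

Definition bounded_solutions n (a : 'I_n -> nat) (m r k : nat) :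
    set (n.-tuple int) :=
  [set t | (\sum_(i < n) (a i)%:Z * tnth t i = r%:Z + k%:Z * m%:Z)%R /\
           forall i : 'I_n, (0 <= tnth t i <= m%:Z - 1)%R].

Definition lstar n (a : 'I_n -> nat) (m r k : nat) : nat :=
  cardinal (bounded_solutions a m r k).

(* Under the hypotheses of [sstar_no_truncation] the subtraction in [nat] is
   the one in the integers. *)
Definition sstar n (a : 'I_n -> nat) (m r : nat) : nat :=
  ((m - 1) * (\sum_(i < n) a i) - r) %/ m.

Lemma sstar_no_truncation n (a : 'I_n -> nat) (m r : nat) :
  0 < n -> (forall i, 0 < a i) -> r < m -> r <= (m - 1) * (\sum_(i < n) a i).
Proof.
case: n a => // n a _ a_gt0 lt_rm; rewrite big_ord_recl.
have r_le : r <= m - 1 by rewrite subn1 -ltnS (ltn_predK lt_rm).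
by apply: (leq_trans r_le); rewrite leq_pmulr // addn_gt0 a_gt0.
Qed.

Lemma finite_tuple_range (T : choiceType) n (f : nat -> T) N (A : set (n.-tuple T)) :
  (forall x, A x -> forall i, exists2 j, j < N & tnth x i = f j) ->
  finite_set A.
Proof.
move=> hA.
pose g (u : n.-tuple 'I_N) : n.-tuple T := [tuple f (tnth u i) | i < n].
apply: (@sub_finite_set _ _ (g @` setT)); last exact/finite_image/finite_finset.
move=> x /hA hx.
have hx' i : exists j : 'I_N, tnth x i = f j.
  by have [j lt_jN ->] := hx i; exists (Ordinal lt_jN).
have [h hE] := choice hx'.
exists [tuple h i | i < n] => //.
by apply: eq_from_tnth => i; rewrite !tnth_mktuple hE.
Qed.

Lemma finite_solutions n (a : 'I_n -> nat) (l : int) :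
  (forall i, 0 < a i) -> finite_set (solutions a l).
Proof.
move=> a_gt0; apply: (@finite_tuple_range _ _ id `|l|.+1) => x /= <- i.
exists (tnth x i) => //; rewrite ltnS absz_nat (bigD1 i) //=.
by apply: leq_trans (leq_addr _ _); rewrite leq_pmull.
Qed.

Lemma finite_bounded_solutions n (a : 'I_n -> nat) (m r k : nat) :
  finite_set (bounded_solutions a m r k).
Proof.
apply: (@finite_tuple_range _ _ Posz m) => t [_ bt] i.
have /andP[] := bt i; case: (tnth t i) => // j _.
by rewrite lerBrDr => lt_jm; exists j => //; rewrite -addn1.
Qed.

(* Main.v *)
Require Import Defs.
From mathcomp Require Import all_boot all_order all_algebra.
From mathcomp Require Import finmap zify.
From mathcomp Require Import classical_sets cardinality.

(** Divide each coordinate of a solution [x] of [sum a_i x_i = b] by [m]: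
    [x_i = t_i + m y_i] with [0 <= t_i < m].  Then
    [sum a_i t_i + m * sum a_i y_i = b], so [sum a_i t_i] is congruent to [r]
    modulo [m] and equals [r + k m] for exactly one natural number [k], the
    carry of [x]; cancelling [r] and dividing by [m] leaves
    [sum a_i y_i = floor (b / m) - k].  Conversely every bounded [t] with
    weighted sum [r + k m] and every [y] with weighted sum [floor (b / m) - k]
    glue back to a solution, uniquely.  Hence the solutions with carry [k] are
    in bijection with a product of two sets, of cardinals [lstar a m r k] and
    [P a (floor (b / m) - k)] ([divmod_tuple_fibre]), and the theorem is the
    sum of these counts over the possible carries.  The sum stops at [sstar]
    because [sum a_i t_i <= (m - 1) * sum a_i] ([carry_le_sstar]). *)

Set Implicit Arguments.
Unset Strict Implicit.
Unset Printing Implicit Defensive.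

Local Open Scope classical_set_scope.

Lemma cardinal_image_inj (T U : choiceType) (f : T -> U) (A : set T) :
  finite_set A -> injective f -> cardinal (f @` A) = cardinal A.
Proof. by move=> finA f_inj; rewrite /cardinal fset_set_image // card_imfset. Qed.

Lemma cardinal_setX (T U : choiceType) (A : set T) (B : set U) :
  finite_set A -> finite_set B ->
  cardinal (A `*` B) = cardinal A * cardinal B.
Proof.
move=> finA finB; rewrite /cardinal fset_setX // !card_fset_sum1.
rewrite (big_imfset2 _ _ (fun=> 1)) /=; last by move=> [x y] [x' y'] _ _ [-> ->].
rewrite big_distrl /=; apply: eq_bigr => x _.
by rewrite mul1n.
Qed.

Lemma cardinal_fibres (T : choiceType) (A : set T) (f : T -> nat) N :
  finite_set A -> (forall x, A x -> f x < N) ->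
  cardinal A = \sum_(0 <= k < N) cardinal (A `&` [set x | f x = k]).
Proof.
move=> finA fN; rewrite big_mkord.
transitivity (\sum_(k < N) \sum_(x <- fset_set A | f x == k) 1).
  rewrite /cardinal card_fset_sum1 (exchange_big_dep xpredT) //=.
  rewrite big_seq_cond [RHS]big_seq_cond; apply: eq_bigr => x.
  rewrite andbT in_fset_set // inE => /fN fxN.
  by rewrite (big_pred1 (Ordinal fxN)).
apply: eq_bigr => k _.
rewrite big_fset_condE -card_fset_sum1; congr #|` _|%fset.
apply/fsetP => x; rewrite !inE !in_fset_set //; last exact: finite_setIl.
by rewrite in_setI; congr andb; apply/idP/idP; rewrite inE => /eqP.
Qed.

(** The first component lives in [int] because the bounded solutions that
    [lstar] counts are integer tuples. *)
Definition divmod_tuple n (m : nat) (x : n.-tuple nat) :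
    n.-tuple int * n.-tuple nat :=
  ([tuple Posz (tnth x i %% m) | i < n], [tuple tnth x i %/ m | i < n]).

Lemma divmod_tuple_inj n m : injective (@divmod_tuple n m).
Proof.
move=> x y exy; apply: eq_from_tnth => i.
have := congr1 (fun p => tnth p.1 i) exy.
have := congr1 (fun p => tnth p.2 i) exy.
rewrite /= !tnth_mktuple => ed [em].
by rewrite (divn_eq (tnth x i) m) ed em -divn_eq.
Qed.

Definition remainder_sum n (a : 'I_n -> nat) m (x : n.-tuple nat) :=
  \sum_(i < n) a i * (tnth x i %% m).

Lemma sum_divn_eq n (a : 'I_n -> nat) m (x : n.-tuple nat) :
  \sum_(i < n) a i * tnth x i =
  (\sum_(i < n) a i * (tnth x i %/ m)) * m + remainder_sum a m x.
Proof.
rewrite big_distrl -big_split /=; apply: eq_bigr => i _.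
by rewrite -mulnA -mulnDr -divn_eq.
Qed.

Lemma remainder_sum_le n (a : 'I_n -> nat) m (x : n.-tuple nat) :
  0 < m -> remainder_sum a m x <= (m - 1) * \sum_(i < n) a i.
Proof.
move=> m_gt0; rewrite big_distrr /=; apply: leq_sum => i _.
by rewrite mulnC leq_mul2r leq_subRL // add1n ltn_pmod // orbT.
Qed.

(** Division moves only multiples of [m] out of the weighted sum. *)
Lemma remainder_sum_mod n (a : 'I_n -> nat) m (x : n.-tuple nat) b :
  solutions a b%:Z%R x -> remainder_sum a m x %% m = b %% m.
Proof. by case=> <-; rewrite (sum_divn_eq a m) modnMDl. Qed.

(** With [R] the sum of the weighted remainders, [R = r + k m] has quotient
    [k] by [m], and [k m = R - r] is at most [(m - 1) * sum a_i - r]. *)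
Lemma carry_le_sstar n (a : 'I_n -> nat) m (x : n.-tuple nat) b :
  0 < m -> solutions a b%:Z%R x ->
  remainder_sum a m x %/ m <= sstar a m (b %% m).
Proof.
move=> m_gt0 /(remainder_sum_mod m) <-; rewrite leq_divRL //.
have := remainder_sum_le a x m_gt0.
by rewrite {1}(divn_eq (remainder_sum a m x) m); lia.
Qed.

(** The constraints on the remainders and on the quotients of [x] decouple
    once the carry [k] is fixed, which makes the image a full product.  When
    [k] exceeds [b %/ m] both sides are empty: a negative integer is not a
    weighted sum of natural numbers. *)
Lemma divmod_tuple_fibre n (a : 'I_n -> nat) m b k :
  0 < m ->
  divmod_tuple m @`
    (solutions a b%:Z%R `&` [set x | remainder_sum a m x %/ m = k]) =
  bounded_solutions a m (b %% m) k `*`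
    solutions a ((b %/ m)%N%:Z - k%:Z)%R.
Proof.
move=> m_gt0.
have fibreE x :
  (solutions a b%:Z%R x /\ remainder_sum a m x %/ m = k) <->
  (remainder_sum a m x = b %% m + k * m /\
   \sum_(i < n) a i * (tnth x i %/ m) + k = b %/ m).
  rewrite /solutions /= (sum_divn_eq a m).
  have := divn_eq b m; have := ltn_pmod b m_gt0.
  set Y := \sum_(i < n) _; set R := remainder_sum a m x.
  move: (b %/ m) (b %% m) => q r lt_rm eb.
  (* Both directions are uniqueness of Euclidean division by [m]: of [R] with
     quotient [k] and remainder [r], and of [b]. *)
  split=> [[[eX] ek]|[eR eY]].
    have eR := divn_eq R m; have lt_Rm := ltn_pmod R m_gt0.
    have er : R %% m = r.
      by rewrite -(modn_small lt_rm) -(modnMDl q r) -eb -eX modnMDl.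
    by split; nia.
  split; first by congr Posz; nia.
  by rewrite eR addnC divnMDl // divn_small ?addn0.
have boundedE x : (bounded_solutions a m (b %% m) k (divmod_tuple m x).1) <->
    remainder_sum a m x = b %% m + k * m.
  rewrite /bounded_solutions /=.
  have -> : (\sum_(i < n) (a i)%:Z *
      tnth [tuple Posz (tnth x i %% m) | i < n] i = (remainder_sum a m x)%:Z)%R.
    rewrite /remainder_sum (big_morph Posz PoszD (erefl _)).
    by apply: eq_bigr => i _; rewrite tnth_mktuple PoszM.
  split=> [[]|e]; first by lia.
  split=> [|i]; first by lia.
  by rewrite tnth_mktuple; have := ltn_pmod (tnth x i) m_gt0; lia.
have quotientE x :
    solutions a ((b %/ m)%N%:Z - k%:Z)%R (divmod_tuple m x).2 <->
    \sum_(i < n) a i * (tnth x i %/ m) + k = b %/ m.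
  rewrite /solutions /=.
  under eq_bigr do rewrite tnth_mktuple.
  by split; lia.
apply/seteqP; split=> [_ [x /fibreE[hR hY] <-]|[t y] [bt sy]].
  by split; [exact/boundedE | exact/quotientE].
(* Gluing; the absolute value only converts [t], which is nonnegative. *)
pose x := [tuple `|tnth t i|%N + tnth y i * m | i < n].
have ex : divmod_tuple m x = (t, y).
  have t_range i : (0 <= tnth t i <= m%:Z - 1)%R by case: bt => _; exact.
  have lt_tm i : `|tnth t i|%N < m by have := t_range i; lia.
  congr pair; apply: eq_from_tnth => i; rewrite !tnth_mktuple addnC.
    by rewrite modnMDl modn_small //; have := t_range i; lia.
  by rewrite divnMDl // divn_small // addn0.
exists x => //; apply/fibreE; split.
  by apply/boundedE; rewrite ex.
by apply/quotientE; rewrite ex.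
Qed.

Theorem theorem4p3 (n : nat) (a : 'I_n -> nat) (b m : nat)
    (hn : 0 < n) (ha : forall i : 'I_n, 0 < a i) (hm : 0 < m) :
  P a b%:Z%R =
  \sum_(0 <= k < (sstar a m (b %% m)).+1)
     lstar a m (b %% m) k * P a ((b %/ m)%N%:Z - k%:Z)%R.
Proof.
have finS l : finite_set (solutions a l) by exact: finite_solutions.
rewrite /P (@cardinal_fibres _ _ (fun x => remainder_sum a m x %/ m)
  (sstar a m (b %% m)).+1) //; last first.
  by move=> x sx; rewrite ltnS; exact: carry_le_sstar.
apply: eq_bigr => k _.
rewrite -(cardinal_image_inj _ (@divmod_tuple_inj n m)); last first.
  exact: finite_setIl.
rewrite divmod_tuple_fibre // cardinal_setX //.
exact: finite_bounded_solutions.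
Qed.
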